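(* Let $D$ be an algebraically closed division ring with center $F$ and let $p$ be a polynomial in non-commuting variables $x_1,\ldots,x_m$ with coefficients in $F$, where $m$ is a positive integer, such that $p$ has zero constant term. If $p(F)\neq\{0\}$, then $p(D)=D$.
   Context: A polynomial in the central variable $x$ over a division ring $D$ is an expression $a_tx^t+\cdots+a_1x+a_0$ with $a_i\in D$, where $x$ commutes with all elements of $D$; $a\in D$ is a (right) root of it if $a_ta^t+\cdots+a_1a+a_0=0$. A division ring $D$ (commutative or not) is (right) algebraically closed if every nonconstant polynomial in a central variable with coefficients in $D$ has a (right) root in $D$. For an $F$-algebra $R$ and a polynomial $p$ in the free algebra $F\langle x_1,\dots,x_m\rangle$, $p(R)=\{p(r_1,\dots,r_m)\mid r_1,\dots,r_m\in R\}$. *)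

(* Defs.v *)
From HB Require Import structures.
From mathcomp Require Import all_boot all_order all_algebra.
From mathcomp Require Import classical_sets.
From mathcomp.multinomials Require Import monalg.

Set Implicit Arguments.
Unset Strict Implicit.
Unset Printing Implicit Defensive.

Import GRing.Theory.

Local Open Scope ring_scope.
Local Open Scope classical_set_scope.

Definition division_ring (D : unitRingType) : Prop :=
  forall x : D, x != 0 -> x \is a GRing.unit.

Definition ring_center (R : nzRingType) : set R :=
  [set z | forall x : R, z * x = x * z].

Arguments ring_center : clear implicits.

(* In {poly D} the variable is central, and q.[a] is the sum of the q`_i * a ^+ i,
   with coefficients on the left, also when D is not commutative; this is the
   evaluation defining right roots. *)
Definition algebraically_closed (D : nzRingType) : Prop :=
  forall q : {poly D}, (1 < size q)%N -> exists a : D, root q a.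

(* {fmonom 'I_m} is the free monoid on m letters, so its monoid algebra is the
   free algebra on x_0, ..., x_(m-1). *)
Notation free_algebra F m := {malg F[{fmonom 'I_m}]}.

Definition constant_term (F : fieldType) (m : nat) (p : free_algebra F m) : F :=
  mcoeff mone p.

Section Evaluation.
Variables (F : fieldType) (m : nat) (R : algType F).

Definition word_eval (r : 'I_m -> R) (w : {fmonom 'I_m}) : R :=
  \prod_(i <- w) r i.

Definition nc_eval (p : free_algebra F m) (r : 'I_m -> R) : R :=
  mmap (in_alg R) (word_eval r) p.

Definition nc_image (p : free_algebra F m) : set R := range (nc_eval p).

End Evaluation.

Arguments nc_image {F m} R p.

(* Main.v *)
(** If [p a != 0] for some [a] in [F^m], then [q := p (a_1 X, ..., a_m X)] in
    [F[X]] takes the values [0] at [0] and [p a] at [1], so it is not constant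
    and, for every [d] in [D], [q - d] has a root [b] in [D]. Since [q] has
    central coefficients, evaluating it at [b] is a ring morphism, whence
    [p (a_1 b, ..., a_m b) = q.[b] = d]. *)

Require Import Defs.
From mathcomp Require Import all_boot all_order all_algebra.
From mathcomp Require Import classical_sets.
From mathcomp.multinomials Require Import monalg.
From mathcomp Require boolp.

Import GRing.Theory.

Local Open Scope ring_scope.
Local Open Scope classical_set_scope.

(** Meant for [f := horner_alg b], to pass from [p] evaluated at polynomials in [X] to [p] evaluated
    at multiples of [b]. *)
Lemma nc_eval_rmorphism (F : fieldType) (A B : algType F)
    (f : {rmorphism A -> B}) (fF : forall c : F, f c%:A = c%:A)
    (m : nat) (p : free_algebra F m) (r : 'I_m -> A) :
  f (nc_eval p r) = nc_eval p (f \o r).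
Proof.
rewrite /nc_eval !mmapE raddf_sum; apply: eq_bigr => w _ /=.
by rewrite rmorphM /= fF; congr (_ * _); apply: rmorph_prod.
Qed.

(** A nonempty word has a letter, which vanishes; only the empty word [mone] contributes. *)
Lemma nc_eval0 (F : fieldType) (A : algType F) (m : nat)
    (p : free_algebra F m) :
  nc_eval p (fun=> 0 : A) = (constant_term p)%:A.
Proof.
have word0 (w : {fmonom 'I_m}) : w != mone -> word_eval (fun=> 0 : A) w = 0.
  case: w => [[|i s]] w1; first by case/eqP: w1; apply/val_inj/esym/fm1.
  by rewrite /word_eval big_cons mul0r.
have word1 : word_eval (fun=> 0 : A) (mone : {fmonom 'I_m}) = 1.
  by rewrite /word_eval fm1 big_nil.
(* Adjoining [mone] to the support lets its term be split off even when its coefficient is zero. *)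
have msupp_sub : finmap.fsubset (msupp p) (finmap.fsetU (finmap.fset1 mone) (msupp p)).
  exact: finmap.fsubsetUr.
rewrite /nc_eval (mmapEw msupp_sub) (finmap.big_fsetD1 mone) ?finmap.fset1U1 //=.
rewrite word1 mulr1 big_seq big1 ?addr0 // => w.
by rewrite finmap.in_fsetD1 => /andP[w1 _]; rewrite word0 ?mulr0.
Qed.

Theorem theorem4p6 (F : fieldType) (D : unitAlgType F)
    (D_division : division_ring D)
    (D_closed : algebraically_closed D)
    (center_D : ring_center D = range (fun a : F => a%:A : D))
    (m : nat) (m_gt0 : (0 < m)%N)
    (p : free_algebra F m) (p_const0 : constant_term p = 0)
    (p_F : nc_image F^o p <> [set 0]) :
  nc_image D p = [set: D].
Proof.
have [a pa_neq0] : exists a : 'I_m -> F^o, nc_eval p a != 0.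
  apply: boolp.contra_notP p_F => pF0; apply/seteqP; split=> [_ [a _ <-]|_ ->] /=.
    by apply/eqP; apply: boolp.contra_notT pF0 => ?; exists a.
  (* The value [0] is attained at the origin, since the constant term vanishes. *)
  by exists (fun=> 0) => //; rewrite nc_eval0 p_const0 scale0r.
pose q : {poly F} := nc_eval p (fun i => a i *: 'X).
(* The algebra is kept general: [F^o] serves to show that [q] is not constant, [D] to conclude. *)
have q_eval (A : algType F) (b : A) :
    horner_alg b q = nc_eval p (fun i => a i *: b).
  have alg_base c : horner_alg b (c%:A : {poly F}) = c%:A.
    by rewrite alg_polyC horner_algC.
  rewrite (nc_eval_rmorphism _ _ _ (horner_alg b) alg_base).
  congr nc_eval; apply: boolp.funext => i /=.
  by rewrite -mul_polyC rmorphM /= horner_algC horner_algX -scalerAl mul1r.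
have q_size : (1 < size q)%N.
  rewrite ltnNge; apply: contra pa_neq0 => /size1_polyC q_const.
  have -> : a = fun i => a i *: (1 : F^o).
    by apply: boolp.funext => i; rewrite /GRing.scale /= mulr1.
  rewrite -q_eval q_const horner_algC -(horner_algC (0 : F^o)) -q_const q_eval.
  rewrite (_ : (fun i => _) = fun=> 0) ?nc_eval0 ?p_const0 ?scale0r //.
  by apply: boolp.funext => i; rewrite scaler0.
apply/seteqP; split=> // d _.
have [b] : exists b, root (map_poly (in_alg D) q - d%:P) b.
  (* The map from [F] to [D] is injective, so it preserves the size of [q]; subtracting a constant
     does not change a size above 1. *)
  apply: D_closed; rewrite size_polyDl ?size_map_poly //.
  by rewrite size_polyN (leq_ltn_trans (size_polyC_leq1 d)).
rewrite rootE hornerD hornerN hornerC subr_eq0 => /eqP qb.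
(* [horner_alg b q] is by definition the value at [b] of [map_poly (in_alg D) q]. *)
by exists (fun i => a i *: b) => //; rewrite -q_eval -qb.
Qed.
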